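(* Let $n = 2^{\alpha-1}p^{\beta-1}$, where $\alpha,\beta>1$ are integers and $p$ is an odd prime with $p<3\cdot 2^{\alpha-1}-1$. Then $n$ divides $\sigma_5(n)$ if and only if $n$ is an even perfect number and $n\neq 496$.
   Context: For a positive integer $n$ and integer $k\ge 1$, $\sigma_k(n)=\sum_{d\mid n} d^k$, the sum over positive divisors $d$ of $n$. A positive integer $n$ is perfect if $\sigma_1(n)=2n$. *)

(* Defs.v *)
From mathcomp Require Import all_boot.

Set Implicit Arguments.
Unset Strict Implicit.
Unset Printing Implicit Defensive.

Definition sigma (k n : nat) : nat := \sum_(d <- divisors n) d ^ k.

Definition perfect (n : nat) : Prop := 0 < n /\ sigma 1 n = 2 * n.

(* Main.v *)
(** Write a, b for alpha, beta. By multiplicativity n divides sigma_5(n) iff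
    2^(a-1) divides 1 + p^5 + ... + p^(5(b-1)) and p^(b-1) divides
    (32^a - 1)/31. Comparing 2-adic valuations, the first condition forces
    b = 2m and 2^(a-1) | (p+1)m.
    If m = 1, the bound on p leaves p + 1 = 2^(a-1) or p + 1 = 2^a. In the first
    case 32^a = 32 (p+1)^5, hence p | 31, which fails; in the second p is the
    Mersenne prime of a perfect number, and p | (32^a - 1)/31 unless p = 31.
    If m > 1, the size of p^(2m-1) bounds m. For p >= 7 this gives
    p + 1 = k 2^(a-3) with k < 12, so p divides 8^5 - k^5: either k = 8, p = 2^a - 1
    and p^2 | 5p, or p is bounded and finitely many (k, a) remain,
    for none of which p^3 divides 32^a - 1. For p = 3, 5 one gets a < 8 directly. *)

From Stdlib Require Import BinNat Nnat.
Require Import Defs.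
From mathcomp Require Import all_boot.
From mathcomp Require Import zify ring.

(** * Multiplicativity of the divisor power sums *)

Lemma sigma_coprime k m n : 0 < m -> 0 < n -> coprime m n ->
  sigma k (m * n) = sigma k m * sigma k n.
Proof.
move=> m0 n0 co.
have mn0 : 0 < m * n by rewrite muln_gt0 m0.
have dm d : (d \in divisors m) = (d %| m) by rewrite dvdn_divisors.
have dn d : (d \in divisors n) = (d %| n) by rewrite dvdn_divisors.
rewrite /sigma (@perm_big _ _ _ _ (divisors (m * n))
  [seq d * e | d <- divisors m, e <- divisors n]).
  rewrite big_allpairs_dep big_distrl /=; apply: eq_bigr => d _.
  by rewrite big_distrr; apply: eq_bigr => e _; rewrite expnMn.
apply: uniq_perm; first exact: divisors_uniq.
  apply: allpairs_uniq; try exact: divisors_uniq.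
  (* For coprime [m] and [n], the gcds with [m] and [n] recover both factors of [d * e]; the same
     gcds invert the product map below. *)
  have fstE d e : d %| m -> e %| n -> gcdn m (d * e) = d.
    move=> hd he; rewrite Gauss_gcdl ?(coprime_dvdr he) //.
    exact/gcdn_idPr.
  have sndE d e : d %| m -> e %| n -> gcdn n (d * e) = e.
    move=> hd he; rewrite Gauss_gcdr; first exact/gcdn_idPr.
    by rewrite coprime_sym; apply: coprime_dvdl hd co.
  move=> _ _ /allpairsP[[d e] /= [hd he ->]] /allpairsP[[d' e'] /= [hd' he' ->]].
  rewrite /= !dm !dn in hd he hd' he' *.
  move=> E.
  by rewrite -(fstE d e) // -{2}(sndE d e) // E fstE // sndE.
move=> x; rewrite -dvdn_divisors //; apply/idP/allpairsP => [hx|[[d e] /=]].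
  exists (gcdn x m, gcdn x n); split; rewrite ?dm ?dn ?dvdn_gcdr //=.
  apply/eqP; rewrite eqn_dvd; apply/andP; split.
    by rewrite muln_gcdl !muln_gcdr !dvdn_gcd hx !(dvdn_mulr _ (dvdnn x)) dvdn_mull.
  rewrite Gauss_dvd ?dvdn_gcdl //.
  apply: coprime_dvdl (dvdn_gcdr _ _) _; apply: coprime_dvdr (dvdn_gcdr _ _) co.
by rewrite dm dn => -[hd he ->]; apply: dvdn_mul.
Qed.

(** * Geometric sums and their link with [sigma] *)

Definition geom (x n : nat) : nat := \sum_(i < n) x ^ i.

Lemma geom0 x : geom x 0 = 0.
Proof. exact: big_ord0. Qed.

Lemma geomS x n : geom x n.+1 = (x * geom x n).+1.
Proof.
rewrite /geom big_ord_recl expn0 add1n big_distrr; congr _.+1.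
by apply: eq_bigr => i _; rewrite expnS.
Qed.

Lemma geomSr x n : geom x n.+1 = geom x n + x ^ n.
Proof. exact: big_ord_recr. Qed.

Lemma geomE x n : 0 < x -> x ^ n = x.-1 * geom x n + 1.
Proof. by move=> x0; rewrite -predn_exp addn1 prednK // expn_gt0 x0. Qed.

(** Pairs the terms of exponents [2i] and [2i + 1]. *)
Lemma geomM2 x m : geom x m.*2 = (x + 1) * geom (x ^ 2) m.
Proof.
elim: m => [|m IH]; first by rewrite !geom0 muln0.
by rewrite doubleS 3!geomS IH; ring.
Qed.

Lemma sigma_primeX k p e : prime p -> sigma k (p ^ e) = geom (p ^ k) e.+1.
Proof.
move=> pp; have p0 := prime_gt0 pp.
rewrite /sigma /geom (@perm_big _ _ _ _ _ [seq p ^ i | i <- iota 0 e.+1]).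
  rewrite big_map -[iota 0 e.+1]/(index_iota 0 e.+1) big_mkord.
  by apply: eq_bigr => i _; rewrite -!expnM mulnC.
apply: uniq_perm; first exact: divisors_uniq.
  rewrite map_inj_uniq ?iota_uniq //.
  by apply: expnI; apply: prime_gt1.
move=> x; rewrite -dvdn_divisors ?expn_gt0 ?p0 //.
apply/dvdn_pfactor/mapP => // -[m hm ->]; exists m => //.
  by rewrite mem_iota.
by move: hm; rewrite mem_iota.
Qed.

Lemma odd_geom x n : odd x -> odd (geom x n) = odd n.
Proof. by move=> ox; elim: n => [|n IH]; rewrite ?geom0 // geomS /= oddM ox IH. Qed.

Lemma geom_gt0 x n : 0 < n -> 0 < geom x n.
Proof. by case: n => // n _; rewrite geomS. Qed.

Lemma coprime_geom x n : coprime x (geom x n.+1).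
Proof. by rewrite geomS -addn1 /coprime mulnC gcdnMDl gcdn1. Qed.

Lemma sigma_2X_primeX k a b p : prime p -> odd p ->
  sigma k (2 ^ a * p ^ b) = geom (2 ^ k) a.+1 * geom (p ^ k) b.+1.
Proof.
move=> pp op.
rewrite sigma_coprime ?expn_gt0 ?prime_gt0 // ?sigma_primeX //.
by rewrite coprimeXl // coprimeXr // coprime2n.
Qed.

(** A geometric sum is 1 modulo its ratio, so each prime power is coprime to the sum built on its
    own prime and must divide the other one. *)
Lemma dvdn_sigma_2X_primeX k a b p : 0 < k -> prime p -> odd p ->
  (2 ^ a * p ^ b %| sigma k (2 ^ a * p ^ b)) =
  (2 ^ a %| geom (p ^ k) b.+1) && (p ^ b %| geom (2 ^ k) a.+1).
Proof.
move=> k0 pp op; rewrite sigma_2X_primeX // Gauss_dvd; last first.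
  by rewrite coprimeXl // coprimeXr // coprime2n.
rewrite Gauss_dvdr; last first.
  have := coprime_geom (2 ^ k) a; rewrite coprime_pexpl // => h.
  by rewrite coprimeXl.
rewrite Gauss_dvdl //.
have := coprime_geom (p ^ k) b; rewrite coprime_pexpl // => h.
by rewrite coprimeXl.
Qed.

(** * Valuations at 2 *)

Lemma logn2_odd n : odd n -> logn 2 n = 0.
Proof. by move=> on; rewrite logn_coprime // coprime2n. Qed.

(** Strong induction by halving an even [n]: pairing terms leaves the factor [x + 1], which is 2
    modulo 4 and so adds exactly one to the valuation. *)
Lemma logn2_geom x n : x = 1 %[mod 4] -> logn 2 (geom x n) = logn 2 n.
Proof.
elim/ltn_ind: n x => n IH x hx.
have ox : odd x by lia.
have [on|en] := boolP (odd n); first by rewrite !logn2_odd ?odd_geom.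
have [->|n0] := posnP n; first by rewrite geom0.
have -> : n = n./2.*2 by lia.
set m := n./2; have m0 : 0 < m by rewrite /m; lia.
rewrite geomM2 lognM ?geom_gt0 ?addn1 // IH; last 2 first.
- by rewrite /m; lia.
- by rewrite -modnXm hx.
have -> : x.+1 = 2 * ((x - 1) %/ 4 * 2 + 1) by lia.
rewrite lognM // ?addn1 // logn_prime // logn2_odd ?addn0; last by rewrite /= oddM andbF.
by rewrite -mul2n lognM // logn_prime.
Qed.

(** The cofactor is [p^4 - p^3 + p^2 - p + 1], grouped to avoid truncated subtraction; it is odd. *)
Lemma expn5_add1 p : 0 < p -> p ^ 5 + 1 = (p + 1) * (p ^ 3 * p.-1 + p * p.-1 + 1).
Proof. by case: p => // q _; rewrite /= -addn1; ring. Qed.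

Lemma logn2_expn5_add1 p : odd p -> logn 2 (p ^ 5 + 1) = logn 2 (p + 1).
Proof.
move=> op; rewrite expn5_add1 ?odd_gt0 //.
rewrite lognM ?addn1 // [X in _ + X]logn2_odd ?addn0 //.
by rewrite /= oddD !oddM; case: p op => //= q; case: (odd q).
Qed.

(** An odd number of odd terms has an odd sum, so [b] is even. Pairing gives
    [(p^5 + 1) * geom (p^10) m] with [p^10] equal to 1 modulo 4, which has the valuation of
    [(p + 1) * m]. *)
Lemma dvdn_geom_expn5 p b e : odd p -> 0 < b -> 0 < e -> 2 ^ e %| geom (p ^ 5) b ->
  exists2 m, b = m.*2 & 2 ^ e %| (p + 1) * m.
Proof.
move=> op b0 e0 dv.
have eb : ~~ odd b.
  have := odd_geom (p ^ 5) b; rewrite oddX op => <- //.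
  rewrite -dvdn2; apply: dvdn_trans dv; exact: dvdn_exp.
have bE : b = b./2.*2 by lia.
have m0 : 0 < b./2 by lia.
exists b./2 => //; move: dv; rewrite {1}bE.
have pos x : 0 < x + 1 by rewrite addn1.
rewrite !pfactor_dvdn ?geom_gt0 ?double_gt0 ?muln_gt0 ?pos //.
rewrite geomM2 !lognM ?geom_gt0 ?pos // logn2_expn5_add1 // logn2_geom //.
rewrite expnAC -modnXm -(modnXm _ _ p).
by have [->|->] : p %% 4 = 1 \/ p %% 4 = 3 by lia.
Qed.

(** * Size estimates *)

Lemma expn32 a : 32 ^ a = (2 ^ a) ^ 5.
Proof. by rewrite -expnM mulnC expnM. Qed.

(** Raising [m] by one multiplies the left side by at most [2^5], the right side by [7^2]. The
    constant 16 serves [14 * (p + 1) <= 16 * p], valid for [p >= 7]. *)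
Lemma ltn_exp5_7 m : 7 <= m -> (16 * m) ^ 5 < 7 ^ (2 * m - 1).
Proof.
move=> /subnK <-; elim: (m - 7) => [|k IH].
  by rewrite add0n -[2 * 7 - 1]/13; lia.
have -> : 2 * (k.+1 + 7) - 1 = 2 + (2 * (k + 7) - 1) by lia.
rewrite expnD.
apply: (@leq_ltn_trans (7 ^ 2 * (16 * (k + 7)) ^ 5)); last by rewrite ltn_pmul2l.
apply: (@leq_trans (2 ^ 5 * (16 * (k + 7)) ^ 5)).
  by rewrite -expnMn leq_exp2r //; lia.
by rewrite leq_pmul2r // expn_gt0; lia.
Qed.

(** Here the left side grows by at most [(3/2)^5 < 3^2]. The constant 12 bounds [2 * (p + 1)] for
    [p <= 5]. *)
Lemma ltn_exp5_3 m : 12 <= m -> (12 * m) ^ 5 < 3 ^ (2 * m - 1).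
Proof.
move=> /subnK <-; elim: (m - 12) => [|k IH].
  by rewrite add0n -[2 * 12 - 1]/23; lia.
have -> : 2 * (k.+1 + 12) - 1 = 2 + (2 * (k + 12) - 1) by lia.
rewrite expnD.
apply: (@leq_ltn_trans (3 ^ 2 * (12 * (k + 12)) ^ 5)); last by rewrite ltn_pmul2l.
rewrite -(@leq_pmul2l (2 ^ 5)) // mulnA -expnMn.
apply: (@leq_trans (3 ^ 5 * (12 * (k + 12)) ^ 5)).
  by rewrite -expnMn leq_exp2r //; lia.
by rewrite leq_pmul2r // expn_gt0; lia.
Qed.

(** * Excluding [p^3] as a divisor of [32^a - 1] *)

Lemma N_of_expn m n : N.of_nat (m ^ n) = N.pow (N.of_nat m) (N.of_nat n).
Proof. by lia. Qed.

Lemma dvdn_N_modulo d m : d %| m -> N.eqb (N.modulo (N.of_nat m) (N.of_nat d)) 0.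
Proof.
case/dvdnP=> q ->.
by rewrite -multE Nat2N.inj_mul N.Div0.mod_mul.
Qed.

(* Computed in binary: [32 ^ a] is out of reach of unary naturals. *)
Lemma cube_ndvd_small p a : p \in [:: 3; 5] -> 1 < a < 8 -> ~~ (p ^ 3 %| 32 ^ a - 1).
Proof.
move=> hp ha; apply/negP => /dvdn_N_modulo.
rewrite -minusE Nat2N.inj_sub !N_of_expn; apply/negP.
have {}ha : a \in iota 2 6 by rewrite mem_iota.
have H : all (fun p => all (fun a => ~~ N.eqb (N.modulo (N.sub (N.pow 32 (N.of_nat a)) 1)
  (N.pow (N.of_nat p) 3)) 0) (iota 2 6)) [:: 3; 5] by vm_compute.
exact: (allP (allP H p hp) a ha).
Qed.

Lemma cube_ndvd_check p k a : 6 < p -> p + 1 = k * 2 ^ (a - 3) -> k < 12 ->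
  2 < a < 22 -> ~~ (p ^ 3 %| 32 ^ a - 1).
Proof.
move=> p6 pk k12 ha; apply/negP => /dvdn_N_modulo.
rewrite -minusE Nat2N.inj_sub !N_of_expn; apply/negP.
have {}k12 : k \in iota 0 12 by rewrite mem_iota.
have {}ha : a \in iota 3 19 by rewrite mem_iota.
pose q k a := N.sub (N.mul (N.of_nat k) (N.pow 2 (N.of_nat (a - 3)))) 1.
have pE : N.of_nat p = q k a.
  have := congr1 N.of_nat pk; rewrite /q -multE Nat2N.inj_mul N_of_expn.
  by move=> <-; lia.
have {}p6 : N.ltb 6 (q k a) by rewrite -pE; lia.
(* The guard drops small values such as [q = 1], whose cube divides everything. *)
have H : all (fun k => all (fun a => N.ltb 6 (q k a) ==>
  ~~ N.eqb (N.modulo (N.sub (N.pow 32 (N.of_nat a)) 1) (N.pow (q k a) 3)) 0)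
  (iota 3 19)) (iota 0 12) by vm_compute.
by rewrite pE; apply: implyP (allP (allP H k k12) a ha) p6.
Qed.

Lemma cube_ndvd p a : 6 < p -> 2 < a -> p < 3 * 2 ^ (a - 1) - 1 ->
  2 ^ (a - 3) %| p + 1 -> ~~ (p ^ 3 %| 32 ^ a - 1).
Proof.
move=> p6 a2 hb /dvdnP[k pk]; apply/negP => p3.
have e2 : 0 < 2 ^ (a - 3) by rewrite expn_gt0.
have aE : 2 ^ a = 8 * 2 ^ (a - 3) by rewrite -[8]/(2 ^ 3) -expnD subnKC.
have a1E : 2 ^ (a - 1) = 4 * 2 ^ (a - 3).
  by rewrite -[4]/(2 ^ 2) -expnD; congr (2 ^ _); lia.
have k12 : k < 12 by rewrite -(@ltn_pmul2r (2 ^ (a - 3))) //; lia.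
have pa : p %| 32 ^ a - 1 by apply: dvdn_trans p3; exact: dvdn_mulr.
have a32 := expn32 a.
have e32 : 0 < 32 ^ a by rewrite expn_gt0.
have [k8|k8] := eqVneq k 8.
  have : 2 ^ a = p + 1 by lia.
  move=> h; move: p3; rewrite a32 h.
  have -> : (p + 1) ^ 5 - 1 = p * ((p ^ 3 + 5 * p ^ 2 + 10 * p + 10) * p + 5).
    have -> : (p + 1) ^ 5 = p * ((p ^ 3 + 5 * p ^ 2 + 10 * p + 10) * p + 5) + 1 by ring.
    by rewrite addnK.
  rewrite expnS dvdn_pmul2l; last by lia.
  (* After cancelling one [p], divisibility by [p] alone already forces [p] to divide 5. *)
  move=> h2; have : p %| (p ^ 3 + 5 * p ^ 2 + 10 * p + 10) * p + 5.
    by apply: dvdn_trans h2; exact: dvdn_mulr.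
  rewrite dvdn_addr ?dvdn_mull // => /dvdn_leq.
  by lia.
have kE : 8 * (p + 1) = k * 2 ^ a by rewrite pk aE; lia.
have m32 : 32 ^ a = 1 %[mod p] by apply/eqP; rewrite eqn_mod_dvd.
(* Fifth powers of [8 * (p + 1) = k * 2^a], where [p + 1] and [32^a] are both 1 modulo [p]. *)
have mk : 8 ^ 5 = k ^ 5 %[mod p].
  have mul1 x y : y = 1 %[mod p] -> x = x * y %[mod p].
    by move=> hy; rewrite -modnMmr hy modnMmr muln1.
  have p1 : (p + 1) ^ 5 = 1 %[mod p] by rewrite -modnXm modnDl modnXm exp1n.
  by rewrite (mul1 (8 ^ 5) _ p1) -expnMn kE expnMn -a32 -mul1.
have leY x y : x < y -> x = y %[mod p] -> p <= y.
  move=> xy /esym/eqP; rewrite (eqn_mod_dvd _ (ltnW xy)) => /dvdn_leq.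
  by rewrite subn_gt0 xy => /(_ isT) h; apply: leq_trans h (leq_subr _ _).
have p18 : p < 2 ^ 18.
  have [k8l|k8g] : k < 8 \/ 8 < k by lia.
    have lt : k ^ 5 < 8 ^ 5 by rewrite ltn_exp2r.
    have := leY _ _ lt (esym mk); clear; lia.
  have lt : 8 ^ 5 < k ^ 5 by rewrite ltn_exp2r.
  have le : k ^ 5 <= 11 ^ 5 by rewrite leq_exp2r.
  have := leq_trans (leY _ _ lt mk) le; clear; lia.
have a21 : a < 22.
  have : 2 ^ (a - 3) <= 2 ^ 18.
    have k0 : 0 < k by case: (k) pk => [|//]; lia.
    have := p18; rewrite -addn1; apply: leq_trans.
    by rewrite pk leq_pmull.
  by rewrite (leq_exp2l _ _ (ltnSn 1)); clear; lia.
by move: p3; apply/negP; apply: (cube_ndvd_check p k a); rewrite // a2.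
Qed.

(** * The case [m > 1] *)

Lemma geom_bound x n : 1 < x -> geom x n < x ^ n.
Proof.
move=> x1; rewrite geomE ?addn1 ?ltnS; last by lia.
by rewrite leq_pmull //; lia.
Qed.

Lemma geom32_ndvd p a m : prime p -> odd p -> 1 < a -> 1 < m ->
  p < 3 * 2 ^ (a - 1) - 1 -> 2 ^ (a - 1) %| (p + 1) * m ->
  ~~ (p ^ (2 * m - 1) %| geom 32 a).
Proof.
move=> pp op a1 m1 hb d2; apply/negP => dp.
have p1 := prime_gt1 pp.
have le2 : 2 ^ (a - 1) <= (p + 1) * m by apply: dvdn_leq d2; lia.
(* [geom 32 a < (2 * 2^(a - 1))^5], and [2^(a - 1) <= (p + 1) * m]. *)
have lep : p ^ (2 * m - 1) < (2 * (p + 1) * m) ^ 5.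
  apply: leq_ltn_trans (dvdn_leq _ dp) _; first by apply: geom_gt0; lia.
  apply: leq_trans (geom_bound 32 a isT) _.
  rewrite expn32 leq_exp2r // -mulnA.
  have -> : 2 ^ a = 2 * 2 ^ (a - 1) by rewrite -expnS; congr (_ ^ _); lia.
  by rewrite leq_pmul2l.
have p3 : p ^ 3 %| 32 ^ a - 1.
  rewrite (geomE 32) // addnK; apply: dvdn_mull; apply: dvdn_trans dp.
  by apply: dvdn_exp2l; lia.
have [p6|p6] := ltnP 6 p.
  have m7 : m < 7.
    rewrite ltnNge; apply/negP => m7.
    (* Splitting off [p^5] reduces to [p = 7]: it absorbs [(p + 1)^5] up to the ratio [(8/7)^5],
       while the remaining power is at least [7^(2m - 6)]. *)
    have e : 2 * m - 1 = 5 + (2 * m - 6) by clear -m7; lia.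
    have lt7 := ltn_exp5_7 m m7; move: lt7 lep; rewrite e !expnD => lt7 lep.
    have le7 : (7 * (2 * (p + 1) * m)) ^ 5 <= (p * (16 * m)) ^ 5.
      by rewrite leq_exp2r //; clear -p6; nia.
    have lep7 : 7 ^ (2 * m - 6) <= p ^ (2 * m - 6).
      by rewrite leq_exp2r //; clear -m7; lia.
    suff : (7 * (2 * (p + 1) * m)) ^ 5 < (7 * (2 * (p + 1) * m)) ^ 5 by rewrite ltnn.
    apply: leq_ltn_trans le7 _; rewrite [ltnRHS]expnMn.
    apply: (@leq_ltn_trans (7 ^ 5 * (p ^ 5 * p ^ (2 * m - 6)))); last first.
      by rewrite (ltn_pmul2l (_ : 0 < 7 ^ 5)) // expn_gt0.
    have p50 : 0 < p ^ 5 by rewrite expn_gt0 prime_gt0.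
    rewrite (mulnCA (7 ^ 5)) (expnMn p) (leq_pmul2l p50).
    by apply: leq_trans (ltnW lt7) _; rewrite (leq_pmul2l (_ : 0 < 7 ^ 5)) ?expn_gt0.
  have a2 : 2 < a.
    rewrite ltnNge; apply/negP => a2.
    have aE : a = 2 by clear -a1 a2; lia.
    by move: hb; rewrite aE -[2 ^ _]/2; clear -p6; lia.
  move: p3; apply/negP; apply: cube_ndvd => //.
  (* every m < 7 divides 60 = 15 * 4 *)
  have : 2 ^ (a - 1) %| 15 * (4 * (p + 1)).
    rewrite mulnA mulnC; apply: dvdn_trans d2 _; apply: dvdn_mul => //.
    by move: m m1 m7 {le2 lep dp}; do 7?case=> //.
  rewrite Gauss_dvdr ?coprimeXl ?coprime2n //.
  have -> : 2 ^ (a - 1) = 4 * 2 ^ (a - 3).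
    by rewrite -[4]/(2 ^ 2) -expnD; congr (2 ^ _); clear -a2; lia.
  by rewrite dvdn_pmul2l.
have p35 : p \in [:: 3; 5].
  by move: p p6 op p1 {pp hb d2 dp le2 lep p3}; do 7?case=> //.
have m12 : m < 12.
  rewrite ltnNge; apply/negP => m12.
  have := ltn_exp5_3 m m12.
  rewrite ltnNge => /negP; apply; apply: leq_trans (_ : p ^ (2 * m - 1) <= _).
    by rewrite leq_exp2r //; clear -p1 op m12; lia.
  apply: leq_trans (ltnW lep) _; rewrite leq_exp2r // leq_pmul2r; clear -p6 op m12; lia.
have a8 : a < 8.
  have : 2 ^ (a - 1) < 2 ^ 7.
    apply: leq_ltn_trans le2 _; apply: (@leq_ltn_trans (6 * 11)) => //.
    by apply: leq_mul; clear -p6 op m12; lia.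
  by rewrite (ltn_exp2l _ _ (ltnSn 1)); clear; lia.
by move: p3; apply/negP/cube_ndvd_small; rewrite // a1.
Qed.

(** * The case [m = 1] *)

Lemma dvdn_geom32_mersenne p a : prime p -> p + 1 = 2 ^ a ->
  (p %| geom 32 a) = (a != 5).
Proof.
move=> pp pa; have [a5|a5] := eqVneq a 5.
  have -> : p = 31 by rewrite a5 in pa; lia.
  (* Since 32 is 1 modulo 31, the five terms sum to 5 there. *)
  by rewrite a5 !geomS geom0; clear; lia.
have p31 : coprime p 31.
  rewrite prime_coprime // dvdn_prime2 //; apply/negP => /eqP pE.
  by case/eqP: a5; apply: (expnI (ltnSn 1)); rewrite -pa pE.
(* Now [31 * geom 32 a = (p + 1)^5 - 1] is a multiple of [p]. *)
rewrite -(Gauss_dvdr _ p31).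
have := geomE 32 a isT; rewrite expn32 -pa.
have -> : (p + 1) ^ 5 = (p ^ 4 + 5 * p ^ 3 + 10 * p ^ 2 + 10 * p + 5) * p + 1 by ring.
by move/addIn <-; rewrite dvdn_mull.
Qed.

Lemma ndvdn_geom32_half_mersenne p a : prime p -> 0 < a -> p + 1 = 2 ^ (a - 1) ->
  ~~ (p %| geom 32 a).
Proof.
move=> pp a0 pa; apply/negP => pg.
have e : 31 * geom 32 a + 1 = p * (32 * (p ^ 4 + 5 * p ^ 3 + 10 * p ^ 2 + 10 * p + 5)) + 32.
  rewrite -(geomE 32 a isT) -[in LHS](subnK a0) addn1 expnS expn32 -pa; ring.
have : p %| 31.
  have : p %| 31 * geom 32 a by apply: dvdn_mull.
  have -> : 31 * geom 32 a =
    p * (32 * (p ^ 4 + 5 * p ^ 3 + 10 * p ^ 2 + 10 * p + 5)) + 31.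
    by apply: (@addIn 1); rewrite e -(addnA _ 31 1).
  by rewrite dvdn_addr ?dvdn_mulr.
rewrite dvdn_prime2 // => /eqP pE.
have a6 : a = 6.
  have : 2 ^ (a - 1) = 2 ^ 5 by rewrite -pa pE.
  by move/(expnI (ltnSn 1)); lia.
(* Six terms, each 1 modulo 31, sum to 6 there. *)
by move: pg; rewrite pE a6 !geomS geom0; clear; lia.
Qed.

(** * Perfect numbers of the given shape *)

Lemma sigma1_2X_primeX_perfect a b p : prime p -> odd p -> 1 < a -> 1 < b ->
  sigma 1 (2 ^ (a - 1) * p ^ (b - 1)) = 2 * (2 ^ (a - 1) * p ^ (b - 1)) <->
  b = 2 /\ p + 1 = 2 ^ a.
Proof.
move=> pp op a1 b1; rewrite sigma_2X_primeX // !expn1.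
have p0 := prime_gt0 pp.
rewrite mulnA -expnS !subn1 !prednK ?(ltnW a1) ?(ltnW b1) //.
have := geomE 2 a isT; rewrite mul1n => ga.
split=> [h|[-> pa]]; last first.
  have -> : geom 2 a = p by apply: (@addIn 1); rewrite -ga.
  by rewrite -pa !geomS geom0 muln0 muln1 addn1 mulnC.
have : p ^ b.-1 %| geom 2 a.
  rewrite -(@Gauss_dvdl _ _ (geom p b)) ?h ?dvdn_mull //.
  have := coprime_geom p b.-1; rewrite prednK ?(ltnW b1) // => ?.
  by rewrite coprimeXl.
case/dvdnP=> c cE.
have pb0 : 0 < p ^ b.-1 by rewrite expn_gt0 p0.
have hc : c * geom p b = 2 ^ a.
  by apply/eqP; rewrite -(eqn_pmul2r pb0) -h cE; apply/eqP; ring.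
(* [c] divides both a power of 2 and the odd number [2^a - 1]. *)
have c1 : c = 1.
  have : c %| 2 ^ a by rewrite -hc dvdn_mulr.
  move/dvdn_pfactor => /(_ isT) [[|j] _ //= cj].
  have : odd (geom 2 a) by have := congr1 odd ga; rewrite oddX addn1 /=; lia.
  by rewrite cE cj expnS -mulnA oddM.
move: hc cE; rewrite c1 !mul1n => hc cE.
(* Now [geom p b = p^(b - 1) + 1], so only two terms are present. *)
have b2 : b = 2.
  move: hc; rewrite ga cE; case: b b1 {h pb0 cE ga} => [|[|b]] // _.
  rewrite geomSr addnC /= => /addnI; case: b => // b.
  by rewrite !geomS; have := geom_gt0 p b; nia.
by split=> //; rewrite ga cE b2 expn1.
Qed.

Theorem theorem1p4 (n alpha beta p : nat)
  (halpha : 1 < alpha) (hbeta : 1 < beta)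
  (hp : prime p) (hpodd : odd p)
  (hpbound : p < 3 * 2 ^ (alpha - 1) - 1)
  (hn : n = 2 ^ (alpha - 1) * p ^ (beta - 1)) :
  n %| sigma 5 n <-> (~~ odd n /\ perfect n) /\ n <> 496.
Proof.
have p0 := prime_gt0 hp.
have n0 : 0 < n by rewrite hn muln_gt0 !expn_gt0 p0.
have nE : ~~ odd n by rewrite hn oddM oddX; clear -halpha; lia.
have a0 := ltnW halpha; have b0 := ltnW hbeta.
have aS : 2 ^ alpha = 2 * 2 ^ (alpha - 1) by rewrite -expnS subn1 prednK.
have perfE : perfect n <-> beta = 2 /\ p + 1 = 2 ^ alpha.
  rewrite -sigma1_2X_primeX_perfect // -hn.
  by split=> [[]|].
have n496 : beta = 2 -> p + 1 = 2 ^ alpha -> n = 496 <-> alpha = 5.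
  (* 496 is half of [31 * 32]. *)
  move=> b2 pa; have n2 : 2 * n = (p + 1) * p by rewrite hn b2 expn1 mulnA -aS pa.
  split=> [n496|a5].
    apply: (expnI (ltnSn 1)); rewrite -pa.
    by suff -> : p = 31 by []; rewrite n496 in n2; clear -n2; nia.
  have p31 : p = 31 by rewrite a5 in pa; clear -pa; lia.
  by rewrite p31 in n2; clear -n2; lia.
rewrite {1 2}hn dvdn_sigma_2X_primeX // !subn1 !prednK // -subn1 -[2 ^ 5]/32.
split=> [/andP[d2 dp]|[[_ /perfE[b2 pa]] n5]].
  have [m bm d2'] : exists2 m, beta = m.*2 & 2 ^ (alpha - 1) %| (p + 1) * m.
    by apply: dvdn_geom_expn5 => //; rewrite subn_gt0.
  have [m1|m1] := ltnP 1 m.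
    have := geom32_ndvd p alpha m hp hpodd halpha m1 hpbound d2'.
    by rewrite mul2n -bm subn1 dp.
  have m1E : m = 1 by clear -hbeta bm m1; lia.
  have b2 : beta = 2 by rewrite bm m1E.
  rewrite b2 expn1 in dp.
  move: d2'; rewrite m1E muln1 => /dvdnP[c pc].
  (* The bound on [p] says [p + 1 < 3 * 2^(alpha - 1)]. *)
  have [c1|c2] : c = 1 \/ c = 2.
    have : c < 3.
      by rewrite -(@ltn_pmul2r (2 ^ (alpha - 1))) ?expn_gt0 // -pc; clear -hpbound; lia.
    by case: c pc => [|[|[|c]]] // ; rewrite ?mul0n ?addn1; auto.
  - rewrite c1 mul1n in pc.
    by have := ndvdn_geom32_half_mersenne p alpha hp a0 pc; rewrite dp.
  rewrite c2 -aS in pc.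
  split; first by split=> //; apply/perfE.
  move/(n496 b2 pc)/eqP; apply/negP.
  by rewrite -(dvdn_geom32_mersenne p alpha hp pc).
rewrite b2 expn1 dvdn_geom32_mersenne //; apply/andP; split; last first.
  by apply/eqP => /(n496 b2 pa).
(* For [beta = 2] the sum is [p^5 + 1], a multiple of [p + 1 = 2^alpha]. *)
rewrite !geomS geom0 muln0 muln1 -[(p ^ 5).+1]addn1 expn5_add1 // pa aS.
by rewrite dvdn_mulr // dvdn_mull.
Qed.
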